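(* Let $m\ge 2$ and $r\ge 1$ be integers and put $d=m+r-1$. Then for every integer $k$ with $1\le k\le d+1$, the number $B_{m,r,k}$ is an integer and \[ \frac{m}{\gcd(m,r-1)}\ \Big|\ B_{m,r,k}. \]
   Context: For an integer $d\ge 0$, $\binom{Y}{d}$ denotes the polynomial $Y(Y-1)\cdots(Y-d+1)/d!$. For integers $m\ge2$, $r\ge1$ and $d=m+r-1$, the shifted-binomial coordinates $B_{m,r,k}\in\mathbb{Q}$ ($1\le k\le d+1$) are defined as the unique rational numbers satisfying the polynomial identity in $n$ \[ \binom{mn}{d}=\sum_{k=1}^{d+1}B_{m,r,k}\binom{n+k-1}{d} \] (the polynomials $\binom{n+k-1}{d}$, $1\le k\le d+1$, form a basis of the $\mathbb{Q}$-vector space of polynomials of degree at most $d$). Divisibility is in $\mathbb{Z}$, and $\gcd(m,0)=m$. *)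

(* Defs.v *)
From HB Require Import structures.
From mathcomp Require Import all_boot all_order all_algebra.
Set Implicit Arguments. Unset Strict Implicit. Unset Printing Implicit Defensive.
Import Order.TTheory GRing.Theory Num.Theory.
Local Open Scope ring_scope.

Definition binom_poly (d : nat) : {poly rat} :=
  (d`!%:R)^-1 *: \prod_(i < d) ('X - (i%:R)%:P).

(* binom(m n, d) = sum_{1 <= k <= d+1} c_k binom(n + k - 1, d) as polynomials
   in n = 'X; the 1-based index k is j.+1. *)
Definition shifted_binom_identity (m d : nat) (c : {ffun 'I_d.+1 -> rat}) : bool :=
  binom_poly d \Po (m%:R *: 'X) ==
  \sum_(j < d.+1) c j *: (binom_poly d \Po ('X + (j%:R)%:P)).

Lemma horner_binom_poly d n : (binom_poly d).[n%:R] = 'C(n, d)%:R.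
Proof.
have fn0 : (d`!)%:R != 0 :> rat by rewrite pnatr_eq0 -lt0n fact_gt0.
rewrite /binom_poly hornerZ; apply: (mulfI fn0); rewrite mulVKf //.
rewrite -natrM mulnC bin_ffact horner_prod.
under eq_bigr do rewrite hornerXsubC.
elim: d {fn0} => [|d IHd]; first by rewrite big_ord0 ffactn0.
rewrite big_ord_recr /= IHd ffactnSr natrM.
have [le_dn|lt_nd] := leqP d n; first by rewrite natrB.
by rewrite ffact_small // !mul0r.
Qed.

Lemma size_binom_poly d : (size (binom_poly d) <= d.+1)%N.
Proof.
apply: leq_trans (size_scale_leq _ _) _.
by rewrite size_prod_XsubC /index_enum -enumT size_enum_ord.
Qed.

Lemma size_binom_poly_comp d (p : {poly rat}) :
  (size p <= 2)%N -> (size (binom_poly d \Po p) <= d.+1)%N.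
Proof.
move=> sp; apply: leq_trans (size_comp_poly_leq _ _) _; rewrite ltnS.
have sb := size_binom_poly d.
apply: (@leq_trans (d * 1)); last by rewrite muln1.
by apply: leq_mul; [move: sb; case: size | move: sp; case: size].
Qed.

Lemma poly_eq_at_nats d (p q : {poly rat}) :
  (size p <= d.+1)%N -> (size q <= d.+1)%N ->
  (forall n, (n <= d)%N -> p.[n%:R] = q.[n%:R]) -> p = q.
Proof.
move=> sp sq pq; apply/eqP; rewrite -subr_eq0; apply/eqP.
apply: (@roots_geq_poly_eq0 _ _ [seq n%:R | n <- iota 0 d.+1]).
- apply/allP => _ /mapP[n nd ->]; move: nd.
  rewrite mem_iota add0n ltnS => /andP[_ nd].
  by rewrite /root hornerD hornerN pq // subrr.
- rewrite map_inj_uniq ?iota_uniq // => a b /eqP.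
  by rewrite eqr_nat => /eqP.
- rewrite size_map size_iota; apply: leq_trans (size_polyD _ _) _.
  by rewrite size_polyN geq_max sp sq.
Qed.

Definition shift_mx d : 'M[rat]_d.+1 := \matrix_(i, j) 'C(d - i + j, d)%:R.

Lemma shift_mx_unit d : shift_mx d \in unitmx.
Proof.
rewrite -unitmx_tr unitmxE det_trig.
  rewrite unitfE; apply/prodf_neq0 => i _.
  by rewrite !mxE subnK -1?ltnS ?ltn_ord // binn oner_neq0.
apply/is_trig_mxP => i j ij; rewrite !mxE bin_small //.
have := ltn_ord j; rewrite ltnS => jd.
by rewrite -[X in (_ < X)%N](subnK jd) ltn_add2l.
Qed.

Lemma shifted_binom_identityE m d (c : {ffun 'I_d.+1 -> rat}) :
  shifted_binom_identity m c =
  (shift_mx d *m (\col_j c j) == \col_(i < d.+1) 'C(m * (d - i), d)%:R).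
Proof.
have ev n : (\sum_(j < d.+1) c j *: (binom_poly d \Po ('X + (j%:R)%:P))).[n%:R]
    = \sum_(j < d.+1) 'C(n + j, d)%:R * c j.
  rewrite horner_sum; apply: eq_bigr => j _.
  by rewrite hornerZ horner_comp hornerD hornerX hornerC -natrD
             horner_binom_poly mulrC.
have ev' n : (binom_poly d \Po (m%:R *: 'X)).[n%:R] = 'C(m * n, d)%:R.
  by rewrite horner_comp [(_ *: 'X).[_]]hornerZ hornerX -natrM horner_binom_poly.
apply/eqP/eqP => [E | /matrixP E].
  apply/matrixP => i j; rewrite !mxE -ev' E ev.
  by apply: eq_bigr => k _; rewrite !mxE.
apply: (@poly_eq_at_nats d) => [||n nd].
- apply: size_binom_poly_comp; apply: leq_trans (size_scale_leq _ _) _.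
  by rewrite size_polyX.
- apply: (big_ind (fun p : {poly rat} => size p <= d.+1)%N).
  + by rewrite size_poly0.
  + move=> p q sp sq; apply: leq_trans (size_polyD _ _) _.
    by rewrite geq_max sp sq.
  + move=> j _; apply: leq_trans (size_scale_leq _ _) _.
    by apply: size_binom_poly_comp; rewrite size_XaddC.
- have lt : (d - n < d.+1)%N by rewrite ltnS leq_subr.
  have := E (Ordinal lt) 0; rewrite !mxE /= subKn // ev ev' => <-.
  by apply: eq_bigr => k _; rewrite !mxE /= subKn.
Qed.

Lemma shifted_binom_exists m d :
  exists c : {ffun 'I_d.+1 -> rat}, shifted_binom_identity m c.
Proof.
pose v : 'cV[rat]_d.+1 := invmx (shift_mx d) *m \col_i 'C(m * (d - i), d)%:R.
exists [ffun j => v j 0]; rewrite shifted_binom_identityE.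
have -> : \col_j [ffun j => v j 0] j = v.
  by apply/matrixP => i j; rewrite mxE ffunE ord1.
by rewrite mulKVmx ?shift_mx_unit.
Qed.

Lemma shifted_binom_unique m d (c c' : {ffun 'I_d.+1 -> rat}) :
  shifted_binom_identity m c -> shifted_binom_identity m c' -> c = c'.
Proof.
rewrite !shifted_binom_identityE => /eqP E /eqP E'.
have /matrixP V : \col_j c j = \col_j c' j.
  by rewrite -[LHS](mulKmx (shift_mx_unit d)) E -E' mulKmx ?shift_mx_unit.
by apply/ffunP => j; have := V j 0; rewrite !mxE.
Qed.

(* The coordinate B_{m,r,k}, meaningful for 1 <= k <= d + 1 where
   d = m + r - 1; out-of-range k give a junk value. *)
Definition shifted_binom_coord (m r k : nat) : rat :=
  xchoose (shifted_binom_exists m (m + r - 1)) (inord k.-1).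

Lemma shifted_binom_coordP m r (d := (m + r - 1)%N) :
  binom_poly d \Po (m%:R *: 'X) =
  \sum_(1 <= k < d.+2)
    shifted_binom_coord m r k *: (binom_poly d \Po ('X + (k.-1%:R)%:P)).
Proof.
rewrite (eqP (xchooseP (shifted_binom_exists m d))) big_add1 /= big_mkord.
by apply: eq_bigr => j _; rewrite /shifted_binom_coord /= inord_val.
Qed.

Lemma shifted_binom_coord_unique m r (d := (m + r - 1)%N) (B : nat -> rat) :
  binom_poly d \Po (m%:R *: 'X) =
    \sum_(1 <= k < d.+2) B k *: (binom_poly d \Po ('X + (k.-1%:R)%:P)) ->
  forall k, (1 <= k <= d.+1)%N -> B k = shifted_binom_coord m r k.
Proof.
rewrite big_add1 /= big_mkord => E k /andP[k0 kd].
have P : shifted_binom_identity m [ffun j : 'I_d.+1 => B j.+1].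
  by apply/eqP; rewrite E; apply: eq_bigr => j _; rewrite ffunE.
rewrite /shifted_binom_coord.
rewrite -(shifted_binom_unique P (xchooseP (shifted_binom_exists m d))).
by rewrite ffunE inordK prednK.
Qed.

(* Main.v *)
Require Import Defs.
From HB Require Import structures.
From mathcomp Require Import all_boot all_order all_algebra.
Set Implicit Arguments. Unset Strict Implicit. Unset Printing Implicit Defensive.
Import Order.TTheory GRing.Theory Num.Theory.
Local Open Scope ring_scope.

(** Evaluating the defining identity at the integers [n = d, d - 1, ..., 0]
    gives a triangular linear system for the coordinates, with integer entries
    and ones on the diagonal. Such a system is solvable over the integers, so
    any common divisor of the values ['C(m * n, d)] divides every coordinate
    ([shifted_binom_coef_int]). Absorption,
    [d * 'C(m * n, d) = m * n * 'C(m * n - 1, d - 1)], shows that [m] divides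
    [d * 'C(m * n, d)], whence [m %/ gcdn m d] divides ['C(m * n, d)]
    ([dvdn_bin_mul]). Finally [gcdn m d = gcdn m (r - 1)], because
    [d = m + (r - 1)]. *)

Lemma dvdn_div_gcd_mul m a b : (0 < m)%N ->
  (m %| a * b)%N -> (m %/ gcdn m a %| b)%N.
Proof.
move=> m0 mab.
have g0 : (0 < gcdn m a)%N by rewrite gcdn_gt0 m0.
have cop : coprime (m %/ gcdn m a) (a %/ gcdn m a).
  rewrite /coprime -(eqn_pmul2r g0) mul1n muln_gcdl.
  by rewrite !divnK ?dvdn_gcdl ?dvdn_gcdr.
rewrite -(Gauss_dvdr _ cop) -(dvdn_pmul2r g0) mulnAC.
by rewrite !divnK ?dvdn_gcdl ?dvdn_gcdr.
Qed.

Lemma dvdn_bin_mul m n d : (0 < m)%N -> (0 < d)%N ->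
  (m %/ gcdn m d %| 'C(m * n, d))%N.
Proof.
case: d => // d m0 _; apply: dvdn_div_gcd_mul => //.
by rewrite -mul_bin_diag -mulnA dvdn_mulr.
Qed.

(** The identity at [n = d - j] reads ['C(m * (d - j), d)] as [c j] plus an
    integer combination of the [c k] with [k > j], since ['C(d - j + k, d)] is
    [1] for [k = j] and [0] for [k < j]; descending induction on [j] applies. *)
Lemma shifted_binom_coef_int m d N (c : {ffun 'I_d.+1 -> rat}) :
  (0 < N)%N -> (forall n, (N %| 'C(m * n, d))%N) ->
  shifted_binom_identity m c -> forall j, c j / N%:R \is a Num.int.
Proof.
move=> N0 Ndvd; rewrite shifted_binom_identityE => /eqP/matrixP E j.
have N0' : N%:R != 0 :> rat by rewrite pnatr_eq0 -lt0n.
have [t] := ubnP (d - j); elim: t j => // t IHt j; rewrite ltnS => djt.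
have jd : (j <= d)%N by rewrite -ltnS.
have := E j 0; rewrite !mxE (bigD1 j) //= !mxE subnK // binn mul1r.
move/(canRL (addrK _)) => ->; rewrite mulrBl rpredB //.
  by rewrite -(divnK (Ndvd (d - j)%N)) natrM mulfK // rpred_nat.
rewrite mulr_suml rpred_sum // => k kj; rewrite !mxE -mulrA.
have [jk|kj'] := ltnP j k.
  rewrite rpredM ?rpred_nat // IHt //; apply: leq_trans djt.
  by apply: ltn_sub2l => //; apply: leq_trans jk _; rewrite -ltnS.
rewrite bin_small ?mul0r ?rpred0 //.
by rewrite -[X in (_ < X)%N](subnK jd) ltn_add2l ltn_neqAle kj.
Qed.

Theorem theorem5p2 (m r : nat) (hm : (2 <= m)%N) (hr : (1 <= r)%N) :
  let d := (m + r - 1)%N in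
  forall k : nat, (1 <= k <= d + 1)%N ->
  exists z : int,
    shifted_binom_coord m r k = z%:~R /\
    ((m %/ gcdn m (r - 1))%N%:Z %| z)%Z.
Proof.
move=> d k _; have m0 : (0 < m)%N by apply: ltnW.
have -> : gcdn m (r - 1) = gcdn m d by rewrite /d -addnBA // gcdnDl.
have d0 : (0 < d)%N by rewrite /d -addnBA // ltn_addr.
set N := (m %/ gcdn m d)%N.
have N0 : (0 < N)%N by rewrite divn_gt0 ?gcdn_gt0 ?m0 // dvdn_leq ?dvdn_gcdl.
have Ndvd n : (N %| 'C(m * n, d))%N by apply: dvdn_bin_mul.
have := shifted_binom_coef_int N0 Ndvd (xchooseP (shifted_binom_exists m d))
          (inord k.-1).
case/intrP => w cw; exists (w * N%:Z); split; last exact: dvdz_mull.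
rewrite intrM -cw divfK //.
by rewrite pnatr_eq0 -lt0n.
Qed.
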